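(* Let $X\in\mathbb{R}^{n\times p}$ be deterministic with $\|X_j\|_2^2=n$ for all $j\in[p]$, let $\beta^*\in\mathbb{R}^p$ have support $S$ with $|S|=s$, let $\sigma>0$, and let $y=X\beta^*+\varepsilon$ with $\varepsilon\sim\mathcal{N}(0,\sigma^2I_n)$. Assume that $X$ satisfies the restricted eigenvalue condition RE($3$, $s$). Let $\lambda_1,\lambda_2>0$, $r=\lambda_2/\lambda_1$, and suppose $\lambda_1=\frac{1+2r}{r}\,2\sigma\sqrt{2\log(p/\delta)/n}$ for some $\delta\in(0,1)$. Let $\hat\beta=\hat\beta^{\lambda_1}$ be a Lasso solution with parameter $\lambda_1$ and let $\bar\beta=\hat\beta^{\lambda_1,\lambda_2}$ be a Bregman Lasso refitting of $\hat\beta$. Then with probability at least $1-\delta$, $$\frac{r+2}{r}\,\frac1n\|X(\beta^*-\bar\beta)\|_2^2+\frac1n\|X(\beta^*-\hat\beta)\|_2^2\le\frac{\lambda_1^2s}{\kappa^2(1,s)}+\frac{9\lambda_1^2s}{4\kappa^2(3,s)} .$$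
   Context: $[p]=\{1,\dots,p\}$; $X_j$ is the $j$-th column of $X$; for $J\subset[p]$, $\Delta_J$ is the subvector of $\Delta$ indexed by $J$ and $J^c=[p]\setminus J$. A Lasso solution with parameter $\lambda_1>0$ is any $\hat\beta^{\lambda_1}\in\arg\min_{\beta\in\mathbb{R}^p}\frac{1}{2n}\|y-X\beta\|_2^2+\lambda_1\|\beta\|_1$. Put $\hat\rho^{\lambda_1}=\frac{1}{\lambda_1n}X^\top(y-X\hat\beta^{\lambda_1})$, which is a subgradient of $\|\cdot\|_1$ at $\hat\beta^{\lambda_1}$. The Bregman divergence of the $\ell_1$-norm is $D^{\rho}(z,w)=\|z\|_1-\|w\|_1-\langle\rho,z-w\rangle$ for $\rho\in\partial\|w\|_1$. A Bregman Lasso refitting of $\hat\beta^{\lambda_1}$ is any $\hat\beta^{\lambda_1,\lambda_2}\in\arg\min_{\beta\in\mathbb{R}^p}\frac{1}{2n}\|y-X\beta\|_2^2+\lambda_2D^{\hat\rho^{\lambda_1}}(\beta,\hat\beta^{\lambda_1})$, with this choice of $\hat\rho^{\lambda_1}$. $X$ satisfies RE($c_0$, $s$), where $c_0>0$ and $s\in[p]$, if there is a constant $\kappa(c_0,s)>0$ such that for all $J\subset[p]$ with $|J|\le s$ and all $\Delta\in\mathbb{R}^p$ (nonzero on $J$), $\|\Delta_{J^c}\|_1\le c_0\|\Delta_J\|_1$ implies $\frac{\|X\Delta\|_2^2}{n\|\Delta_J\|_2^2}\ge\kappa^2(c_0,s)$. RE($3$, $s$) implies RE($1$, $s$); $\kappa(3,s)$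 and $\kappa(1,s)$ denote such constants. *)

(* Defs.v *)
From HB Require Import structures.
From mathcomp Require Import all_boot all_order all_algebra.
From mathcomp Require Import all_classical all_reals all_analysis.
Import Order.TTheory GRing.Theory Num.Theory.
Import numFieldNormedType.Exports.
Set Implicit Arguments.
Unset Strict Implicit.
Unset Printing Implicit Defensive.
Local Open Scope classical_set_scope.
Local Open Scope ring_scope.

Section vectors.
Context {R : realType}.

(* [`|v|] on matrices is the sup norm, hence these explicit norms. *)
Definition l1norm m (v : 'cV[R]_m) : R := \sum_i `|v i 0|.
Definition sqnorm2 m (v : 'cV[R]_m) : R := \sum_i v i 0 ^+ 2.
Definition dotv m (u v : 'cV[R]_m) : R := \sum_i u i 0 * v i 0.

(* Norms of the subvector of [v] indexed by [J]. *)
Definition l1norm_on m (J : {set 'I_m}) (v : 'cV[R]_m) : R :=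
  \sum_(i in J) `|v i 0|.
Definition sqnorm2_on m (J : {set 'I_m}) (v : 'cV[R]_m) : R :=
  \sum_(i in J) v i 0 ^+ 2.

Definition vsupport m (v : 'cV[R]_m) : {set 'I_m} :=
  [set i : 'I_m | v i 0 != 0]%SET.

End vectors.

Definition is_argmin (T : Type) (R : realType) (f : T -> R) (x : T) : Prop :=
  forall z, f x <= f z.

Section estimators.
Context {R : realType} {n p : nat}.
Variables (X : 'M[R]_(n, p)) (y : 'cV[R]_n).
Implicit Types b z w rho : 'cV[R]_p.

Definition least_squares b : R := (2 * n%:R)^-1 * sqnorm2 (y - X *m b).

Definition lasso_solution (lambda1 : R) b : Prop :=
  is_argmin (fun b' => least_squares b' + lambda1 * l1norm b') b.

(* A Bregman divergence only when [rho] is a subgradient of the l1-norm at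
   [w]; [lasso_subgradient lambda1 b] is one at [b] for [b] a Lasso solution,
   by first-order optimality. *)
Definition bregman_l1 rho z w : R := l1norm z - l1norm w - dotv rho (z - w).

Definition lasso_subgradient (lambda1 : R) b : 'cV[R]_p :=
  (lambda1 * n%:R)^-1 *: (X^T *m (y - X *m b)).

Definition bregman_lasso_refitting (lambda1 lambda2 : R) bhat b : Prop :=
  is_argmin (fun b' => least_squares b' +
    lambda2 * bregman_l1 (lasso_subgradient lambda1 bhat) b' bhat) b.

End estimators.

(* [X] satisfies RE(c0, s) with constant [kappa] = kappa(c0, s). Any valid
   constant is allowed, not only the largest one. *)
Definition restricted_eigenvalue (R : realType) (n p : nat)
    (X : 'M[R]_(n, p)) (c0 : R) (s : nat) (kappa : R) : Prop :=
  [/\ 0 < c0, (0 < s <= p)%N, 0 < kappa &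
    forall (J : {set 'I_p}) (D : 'cV[R]_p),
      (#|J| <= s)%N -> (exists2 j, j \in J & D j 0 != 0) ->
      l1norm_on (~: J) D <= c0 * l1norm_on J D ->
      kappa ^+ 2 <= sqnorm2 (X *m D) / (n%:R * sqnorm2_on J D)].

Section noise.
Local Open Scope ereal_scope.
Context {R : realType} d {Omega : measurableType d} (P : probability Omega R).

Definition mutually_independent n (Z : 'I_n -> {RV P >-> R}) : Prop :=
  forall (J : {set 'I_n}) (B : 'I_n -> set R),
    (forall i, measurable (B i)) ->
    P [set w | forall i, i \in J -> B i (Z i w)] =
      \prod_(i in J) P (Z i @^-1` B i).

(* The random vector (Z_1, ..., Z_n) has law N(0, sigma^2 I_n); the second
   parameter of [normal_prob] is the standard deviation. *)
Definition isotropic_gaussian n (Z : 'I_n -> {RV P >-> R}) (sigma : R) : Prop :=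
  mutually_independent Z /\
  forall (i : 'I_n) (B : set R), measurable B ->
    distribution P (Z i) B = normal_prob 0 sigma B.

(* Inner-probability form: [A] need not be measurable. For measurable [A] this
   is equivalent to [q%:E <= P A]. *)
Definition with_probability_at_least (q : R) (A : set Omega) : Prop :=
  exists E : set Omega, [/\ measurable E, E `<=` A & q%:E <= P E].

End noise.

(* Main.v *)
(** Writing a = X(beta* - betabar) and b = X(beta* - betahat), four first-order
    optimality conditions (Lasso tested at beta* and betabar, refitting tested
    at beta* and betahat) add up, with all terms <b, a> and <eps, b> cancelling,
    to
      (1 + 1/r) |a|^2 + |b|^2 + (2 + 1/r) <eps, a>
        <= n lambda1 (2 |beta*|_1 - |betabar|_1 - |betahat|_1).
    As the noise meets a only, it uses up half of lambda1 |beta* - betabar|_1,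
    which leaves a cone of constant 3 for betabar and of constant 1 for betahat;
    the restricted eigenvalues and AM-GM conclude. The noise level is controlled
    by the exact normal law of each <X_j, eps>, whose two-sided tail is at most
    exp(-t^2/2) without a factor 2, and a union bound over the p columns. *)
Require Import Defs.
From HB Require Import structures.
From mathcomp Require Import all_boot all_order all_algebra.
From mathcomp Require Import ring lra.
From mathcomp Require Import all_classical all_reals all_analysis.
From mathcomp Require Import measurable_realfun normal_distribution.
Import Order.TTheory GRing.Theory Num.Theory.
Import numFieldNormedType.Exports.
Local Open Scope classical_set_scope.
Local Open Scope ring_scope.

(** * Affine changes of variables for Lebesgue measure and normal laws *)

(** As a function of [A], the right-hand side is a scaled pushforward measure, so uniqueness of
    Lebesgue measure leaves only the intervals []a, b]]. Their preimages are again half-open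
    intervals, closed at the other end when [c < 0]. *)
Lemma lebesgue_measure_affine (R : realType) (x c : R) (A : set R) :
  c != 0 -> measurable A ->
  lebesgue_measure A =
  (`|c|%:E * lebesgue_measure ((fun z : R => (x + c * z)%R) @^-1` A))%E.
Proof.
move=> c0 mA.
have mphi : measurable_fun [set: measurableTypeR R]
    ((fun z : R => x + c * z) : measurableTypeR R -> measurableTypeR R).
  by apply: measurable_funD => //; apply: measurable_funM.
pose nu : {measure set (measurableTypeR R) -> \bar R} :=
  mscale (NngNum (normr_ge0 c))
    (measure_function_pushforward__canonical__measure_function_Measure
       lebesgue_measure mphi).
have nuE B : nu B =
  (`|c|%:E * lebesgue_measure ((fun z : R => (x + c * z)%R) @^-1` B))%E by [].
rewrite -nuE; apply: (@lebesgue_measure_unique R nu) => // _ [[a b]] _ <-.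
rewrite nuE lebesgue_measure_itv /= lte_fin.
have [cp|cn] := ltP 0 c.
  rewrite [X in lebesgue_measure X](_ : _ =
      [set` `](a - x) / c, (b - x) / c]]); last first.
    apply/seteqP; split=> z /=;
      by rewrite !in_itv /= ltr_pdivrMr // ler_pdivlMr // [z * c]mulrC ltrBlDl lerBrDl.
  rewrite lebesgue_measure_itv /= lte_fin ltr_pM2r ?invr_gt0 // ltrD2r gtr0_norm //.
  case: ifP => ab; last by rewrite mule0.
  by rewrite -!EFinD -EFinM; congr EFin; field.
have {cn}cn : c < 0 by rewrite lt_neqAle c0.
rewrite [X in lebesgue_measure X](_ : _ =
    [set` `[(b - x) / c, (a - x) / c[]); last first.
  apply/seteqP; split=> z /=;
    rewrite !in_itv /= ler_ndivrMr // ltr_ndivlMr // [z * c]mulrC ltrBlDl lerBrDl;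
    by rewrite andbC.
rewrite lebesgue_measure_itv /= lte_fin ltr_nM2r ?invr_lt0 // ltrD2r ltr0_norm //.
case: ifP => ab; last by rewrite mule0.
by rewrite -!EFinD -EFinM; congr EFin; field.
Qed.

Lemma ge0_integration_by_affine_substitution (R : realType) (x c : R)
    (A : set R) (f : R -> \bar R) :
  c != 0 -> measurable A -> measurable_fun [set: R] f ->
  (forall z, 0 <= f z)%E ->
  (\int[lebesgue_measure]_(u in A) f u =
   `|c|%:E * \int[lebesgue_measure]_(z in (fun z : R => (x + c * z)%R) @^-1` A)
     f (x + c * z)%R)%E.
Proof.
move=> c0 mA mf f0.
have mphi : measurable_fun [set: measurableTypeR R]
    ((fun z : R => x + c * z) : measurableTypeR R -> measurableTypeR R).
  by apply: measurable_funD => //; apply: measurable_funM.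
pose nu := measure_function_pushforward__canonical__measure_function_Measure
  lebesgue_measure mphi.
rewrite (@eq_measure_integral _ _ _ _ (mscale (NngNum (normr_ge0 c)) nu)); last first.
  by move=> B mB _; exact: lebesgue_measure_affine.
rewrite ge0_integral_mscale //=; last exact: measurable_funTS.
congr (_ * _)%E.
by rewrite /nu /= ge0_integral_pushforward //=; exact: measurable_funTS.
Qed.

Lemma normal_prob_affine (R : realType) (m s x c : R) (A : set R) :
  s != 0 -> c != 0 -> measurable A ->
  normal_prob m s ((fun z : R => x + c * z) @^-1` A) =
  normal_prob (x + c * m) (c * s) A.
Proof.
move=> s0 c0 mA; rewrite /normal_prob.
rewrite [RHS](ge0_integration_by_affine_substitution _ x _ _ _ c0 mA); first last.
- by move=> z; rewrite lee_fin normal_pdf_ge0.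
- by apply/measurable_EFinP; exact: measurable_normal_pdf.
have mphi : measurable_fun [set: R] (fun z : R => x + c * z).
  by apply: measurable_funD => //; apply: measurable_funM.
rewrite -ge0_integralZl_EFin //; last first.
- apply: measurable_funTS; apply/measurable_EFinP.
  exact: measurableT_comp (measurable_normal_pdf _ _) mphi.
- by move=> z _; rewrite lee_fin normal_pdf_ge0.
- by rewrite -[X in measurable X]setTI; exact: mphi.
apply: eq_integral => z _; rewrite -EFinM; congr EFin.
rewrite !normal_pdfE ?mulf_neq0 // /normal_peak /normal_fun mulrA; congr (_ * expR _).
  (* The square root turns [c ^+ 2] into [|c|], which the Jacobian factor cancels. *)
  rewrite exprMn -[c ^+ 2 * _ * _]mulrA -(mulrnAr (c ^+ 2)) sqrtrM ?sqr_ge0 // sqrtr_sqr invfM mulrA.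
  by rewrite divff ?mul1r // normr_eq0.
by field; rewrite s0 c0.
Qed.

(** * Densities and convolution of normal laws *)

(** Change of variables gives the Radon-Nikodym derivative as density. It agrees almost everywhere
    with [normal_pdf], as both have the same integral over every measurable set. *)
Lemma ge0_integral_normal_prob (R : realType) (m s : R) (f : R -> \bar R) :
  measurable_fun [set: R] f -> (forall x, 0 <= f x)%E ->
  (\int[normal_prob m s]_x f x =
   \int[lebesgue_measure]_x (f x * (normal_pdf m s x)%:E))%E.
Proof.
move=> mf f0; have dom := @normal_prob_dominates R m s.
have mpdf : measurable_fun [set: R] (EFin \o normal_pdf m s).
  by apply/measurable_EFinP; exact: measurable_normal_pdf.
have RNint := Radon_Nikodym_SigmaFinite.f_integrable dom.
rewrite -(Radon_Nikodym_SigmaFinite.change_of_variables dom) //.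
apply: ae_eq_integral => //.
- exact: emeasurable_funM (measurable_int _ RNint).
- exact: emeasurable_funM.
apply: ae_eqe_mul2l; apply: integral_ae_eq => // A _ mA.
by rewrite -Radon_Nikodym_SigmaFinite.f_integral.
Qed.

Lemma normal_pdf_mul (R : realType) (s t x u : R) : s != 0 -> t != 0 ->
  let v : R := Num.sqrt (s ^+ 2 + t ^+ 2) in
  normal_pdf 0 s x * normal_pdf x t u =
  normal_pdf 0 v u * normal_pdf (u * s ^+ 2 / v ^+ 2) (s * t / v) x.
Proof.
move=> s0 t0 v.
have v20 : 0 < s ^+ 2 + t ^+ 2 by rewrite addr_gt0 // exprn_even_gt0.
have v0 : 0 < v by rewrite sqrtr_gt0.
have vE : v ^+ 2 = s ^+ 2 + t ^+ 2 by rewrite sqr_sqrtr // ltW.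
have vn0 := lt0r_neq0 v0.
clearbody v.
have w0 : s * t / v != 0 by rewrite !mulf_neq0 // invr_eq0.
rewrite !normal_pdfE // /normal_peak /normal_fun.
rewrite [LHS]mulrACA [RHS]mulrACA -!expRD; congr (_ * expR _).
  have p0 w : 0 <= w ^+ 2 * pi *+ 2 :> R.
    by rewrite mulrn_wge0 // mulr_ge0 ?sqr_ge0 ?pi_ge0.
  rewrite -!invfM -(sqrtrM _ (p0 s)) -(sqrtrM _ (p0 v)) !exprMn exprVn.
  congr (Num.sqrt _)^-1. by field.
rewrite expr_div_n vE.
by field; rewrite s0 t0 /= lt0r_neq0.
Qed.

(** Centering the density moves [x] into an integrand that is jointly measurable in [x] and [u], so
    Tonelli applies. *)
Lemma measurable_normal_prob_mean (R : realType) (t : R) (A : set R) :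
  t != 0 -> measurable A ->
  measurable_fun [set: R] (fun x : R => normal_prob x t A).
Proof.
move=> t0 mA.
have mh : measurable_fun setT
    (fun z : R * R => (\1_A z.2 * normal_pdf 0 t (z.2 - z.1))%:E).
  apply/measurable_EFinP; apply: measurable_funM.
    exact: (measurableT_comp (measurable_indic _)).
  apply: measurableT_comp (measurable_normal_pdf _ _) _.
  exact: measurable_funB.
rewrite (_ : (fun x => _) =
    fun x => (\int[lebesgue_measure]_u (\1_A u * normal_pdf 0 t (u - x))%:E)%E).
  apply: (@measurable_fun_fubini_tonelli_F _ _ _ _ _ lebesgue_measure _ mh).
  by move=> z; rewrite lee_fin mulr_ge0 // normal_pdf_ge0.
apply/funext => x; rewrite /normal_prob.
rewrite [LHS]integral_mkcond; apply: eq_integral => u _.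
rewrite patchE indicE; case: ifP => _; last by rewrite mul0r.
by rewrite mul1r !normal_pdfE //= normal_fun_center.
Qed.

(** After a Tonelli exchange, [normal_pdf_mul] makes the inner integral over [x] that of a
    conditional density, which is 1; the marginal of [u] remains. *)
Lemma normal_prob_convolution (R : realType) (s t : R) (A : set R) :
  s != 0 -> t != 0 -> measurable A ->
  (\int[normal_prob 0 s]_x normal_prob x t A =
   normal_prob 0 (Num.sqrt (s ^+ 2 + t ^+ 2)) A)%E.
Proof.
move=> s0 t0 mA; set v := Num.sqrt _.
pose g (z : R * R) : R := normal_pdf 0 s z.1 * normal_pdf z.1 t z.2.
have gE x u : g (x, u) =
    normal_pdf 0 v u * normal_pdf (u * s ^+ 2 / v ^+ 2) (s * t / v) x.
  exact: normal_pdf_mul.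
have mg : measurable_fun setT (fun z => (\1_A z.2 * g z)%:E).
  apply/measurable_EFinP; apply: measurable_funM.
    exact: (measurableT_comp (measurable_indic _)).
  rewrite /g; apply: measurable_funM.
    exact: measurableT_comp (measurable_normal_pdf _ _) _.
  rewrite (_ : (fun z => _) = (fun z : R * R => normal_pdf 0 t (z.2 - z.1))).
    apply: measurableT_comp (measurable_normal_pdf _ _) _.
    exact: measurable_funB.
  apply/funext => z; rewrite !normal_pdfE // normal_fun_center /=.
  by rewrite /normal_fun subr0.
have E x : (normal_prob x t A * (normal_pdf 0 s x)%:E =
    \int[lebesgue_measure]_u (\1_A u * g (x, u))%:E)%E.
  rewrite /normal_prob muleC -ge0_integralZl_EFin ?normal_pdf_ge0 //; last 2 first.
  - by move=> z _; rewrite lee_fin normal_pdf_ge0.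
  - apply: measurable_funTS; apply/measurable_EFinP; exact: measurable_normal_pdf.
  rewrite integral_mkcond; apply: eq_integral => u _.
  rewrite patchE indicE; case: ifP => _; last by rewrite mul0r.
  by rewrite mul1r /g /= EFinM.
rewrite ge0_integral_normal_prob //; last exact: measurable_normal_prob_mean.
under eq_integral do rewrite E.
transitivity (\int[lebesgue_measure]_u \int[lebesgue_measure]_x
    (\1_A u * g (x, u))%:E)%E.
  have := @fubini_tonelli _ _ _ _ R lebesgue_measure lebesgue_measure _ mg.
  by apply=> z; rewrite lee_fin mulr_ge0 // mulr_ge0 // normal_pdf_ge0.
rewrite [RHS]integral_mkcond; apply: eq_integral => u _.
rewrite patchE; under eq_integral do rewrite gE indicE.
case: ifP => _; last by under eq_integral do rewrite mul0r; rewrite integral0.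
under eq_integral do rewrite mul1r EFinM.
rewrite ge0_integralZl_EFin ?normal_pdf_ge0 //.
- by rewrite integral_normal_pdf mule1.
- by move=> x _; rewrite lee_fin normal_pdf_ge0.
- by apply/measurable_EFinP; exact: measurable_normal_pdf.
Qed.

(** * Centered normal laws, including variance zero *)

Lemma normal_prob_sqrt_sqr (R : realType) (m s : R) (A : set R) :
  normal_prob m (Num.sqrt (s ^+ 2)) A = normal_prob m s A.
Proof.
rewrite sqrtr_sqr; apply: eq_integral => x _; congr EFin.
by rewrite /normal_pdf /normal_peak /normal_fun normr_eq0 real_normK ?num_real.
Qed.

(* [normal_prob m 0] is a uniform law, not a point mass, so the degenerate
   case has to be treated apart. The parameter is the variance. *)
Definition centered_normal (R : realType) (v : R) :
    probability (measurableTypeR R) R :=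
  if v == 0 then (\d_(0 : measurableTypeR R) : probability _ _)
  else (normal_prob 0 (Num.sqrt v) : probability _ _).

Lemma centered_normalE (R : realType) (v : R) (A : set R) : v != 0 ->
  centered_normal R v A = normal_prob 0 (Num.sqrt v) A.
Proof. by rewrite /centered_normal => /negPf ->. Qed.

(** This is the law of [x + c * z] for independent [x] and [z]. For [c = 0] the inner probability is
    the indicator of [A] at [x]; for [v = 0] the Dirac mass evaluates the integrand at 0; otherwise
    two normal laws are convolved. *)
Lemma centered_normal_convolution (R : realType) (v s c : R) (A : set R) :
  0 <= v -> s != 0 -> measurable A ->
  (\int[centered_normal R v]_x
     normal_prob 0 s ((fun z : R => (x + c * z)%R) @^-1` A) =
   centered_normal R (v + (c * s) ^+ 2) A)%E.
Proof.
move=> v0 s0 mA; have [->|c0] := eqVneq c 0.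
  rewrite mul0r expr0n addr0.
  transitivity (\int[centered_normal R v]_x (\1_A x)%:E)%E; last first.
    by rewrite integral_indic // setIT.
  apply: eq_integral => x _.
  rewrite indicE; have [xA|xA] := boolP (x \in A).
    rewrite [X in normal_prob _ _ X](_ : _ = setT) ?probability_setT //.
    by apply/seteqP; split=> z //= _; rewrite mul0r addr0; exact/set_mem.
  rewrite [X in normal_prob _ _ X](_ : _ = set0) ?measure0 //.
  by apply/seteqP; split=> z //=; rewrite mul0r addr0 => /mem_set; rewrite (negPf xA).
have cs0 : c * s != 0 by rewrite mulf_neq0.
under eq_integral do rewrite (normal_prob_affine _ _ _ _ _ _ s0 c0 mA) mulr0 addr0.
have cs2 : 0 < (c * s) ^+ 2 by rewrite exprn_even_gt0.
rewrite [RHS]centered_normalE; last by rewrite lt0r_neq0 // ltr_wpDl.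
have [->|vn0] := eqVneq v 0.
  rewrite /centered_normal eqxx add0r normal_prob_sqrt_sqr.
  rewrite integral_dirac ?diracT ?mul1e //.
  exact: measurable_normal_prob_mean.
rewrite /centered_normal (negPf vn0) normal_prob_convolution //.
  by rewrite sqr_sqrtr.
by rewrite sqrtr_eq0 -ltNge lt_neqAle eq_sym vn0.
Qed.

(** * Two-sided Gaussian tail *)

(** Expanding the square, the density at [c + z] is the density at [z] times exp(-c^2/(2s^2)) times
    exp(-cz/s^2), and the last factor is at most 1 on the shifted set. The shift is written
    [c + 1 * z] to match the affine substitution. *)
Lemma normal_prob_shift_le (R : realType) (s c : R) (B : set R) :
  s != 0 -> measurable B -> (forall z, B (c + z) -> 0 <= c * z) ->
  (normal_prob 0 s B <= (expR (- c ^+ 2 / (s ^+ 2 *+ 2)))%:E *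
     normal_prob 0 s ((fun z : R => (c + 1 * z)%R) @^-1` B))%E.
Proof.
move=> s0 mB Bc; rewrite /normal_prob.
have mphi : measurable_fun [set: R] (fun z : R => c + 1 * z).
  by apply: measurable_funD => //; apply: measurable_funM.
have mpdf : measurable_fun [set: R] (fun z : R => (normal_pdf 0 s z)%:E).
  by apply/measurable_EFinP; exact: measurable_normal_pdf.
have mB' : measurable ((fun z : R => c + 1 * z) @^-1` B).
  by rewrite -[X in measurable X]setTI; exact: mphi.
rewrite (ge0_integration_by_affine_substitution _ c 1) ?oner_neq0 //; last first.
  by move=> z; rewrite lee_fin normal_pdf_ge0.
rewrite normr1 mul1e -ge0_integralZl_EFin ?expR_ge0 //; last 2 first.
- by move=> z _; rewrite lee_fin normal_pdf_ge0.
- exact: measurable_funTS.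
apply: ge0_le_integral => //.
- by move=> z _; rewrite lee_fin normal_pdf_ge0.
- by apply: measurable_funTS; exact: measurableT_comp mpdf mphi.
- by apply: measurable_funTS; apply: measurable_funeM.
move=> z; rewrite /= mul1r => /Bc cz; rewrite -EFinM lee_fin.
rewrite !normal_pdfE // /normal_fun mulrCA ler_wpM2l ?normal_peak_ge0 // -expRD ler_expR.
rewrite -mulrDl ler_wpM2r ?invr_ge0 ?mulrn_wge0 ?sqr_ge0 // !subr0; nra.
Qed.

(** Shifting by [t] and by [- t] sends the two tails to the half-lines [z > 0] and [z < 0]. These
    are disjoint, so their total mass is at most 1 and no factor 2 appears. *)
Lemma normal_prob_tail (R : realType) (s t : R) : s != 0 -> 0 <= t ->
  (normal_prob 0 s [set x : R | (t < `|x|)%R] <= (expR (- t ^+ 2 / (s ^+ 2 *+ 2)))%:E)%E.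
Proof.
move=> s0 t0.
have mR : measurable [set x : R | t < x].
  have -> : [set x : R | t < x] = [set` `]t, +oo[].
    by apply/seteqP; split=> x /=; rewrite in_itv /= andbT.
  exact: measurable_itv.
have mL : measurable [set x : R | x < - t].
  have -> : [set x : R | x < - t] = [set` `]-oo, (- t)[].
    by apply/seteqP; split=> x /=; rewrite in_itv.
  exact: measurable_itv.
have -> : [set x : R | t < `|x|] = [set x : R | t < x] `|` [set x : R | x < - t].
  apply/seteqP; split=> x /=; rewrite lter_normr ltrNr.
    by move/orP.
  by move=> ?; apply/orP.
rewrite measureU //; last by apply/seteqP; split=> x //= [? ?]; lra.
have mphi c : measurable_fun [set: R] (fun z : R => c + 1 * z).
  by apply: measurable_funD => //; apply: measurable_funM.
have HR := @normal_prob_shift_le R s t _ s0 mR.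
have HL := @normal_prob_shift_le R s (- t) _ s0 mL.
apply: (le_trans (leeD (HR _) (HL _))).
- by move=> z /=; nra.
- by move=> z /=; nra.
rewrite sqrrN -ge0_muleDr // -measureU //; first last.
- by apply/seteqP; split=> x //= [? ?]; lra.
- by rewrite -[X in measurable X]setTI; apply: mphi.
- by rewrite -[X in measurable X]setTI; apply: mphi.
rewrite -[leRHS]mule1 lee_wpmul2l ?lee_fin ?expR_ge0 //.
by apply: probability_le1; apply: measurableU; rewrite -[X in measurable X]setTI; apply: mphi.
Qed.

(** * Linear combinations of independent Gaussians *)

(** The induction step for partial sums: [E] is the event on later coordinates and [C] its
    probability. The law of ([U], [V]) restricted to [E] agrees on rectangles with a product measure
    whose first factor carries [C], hence equals it; sections and the convolution formula finish. *)
Lemma normal_combination_restr d (Omega : measurableType d) (R : realType)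
    (P : probability Omega R) (U V : Omega -> R) (E : set Omega)
    (v s c : R) (C : {nonneg R}) :
  measurable_fun setT U -> measurable_fun setT V -> measurable E ->
  0 <= v -> s != 0 ->
  (forall A B : set R, measurable A -> measurable B ->
     P (U @^-1` A `&` V @^-1` B `&` E) =
     C%:num%:E * centered_normal R v A * normal_prob 0 s B)%E ->
  forall A : set R, measurable A ->
    P ([set w | A (U w + c * V w)] `&` E) =
    (C%:num%:E * centered_normal R (v + (c * s) ^+ 2) A)%E.
Proof.
move=> mU mV mE v0 s0 HUV A mA.
have mUV : measurable_fun [set: Omega]
    ((fun w => (U w, V w)) : Omega -> measurableTypeR R * measurableTypeR R).
  exact/measurable_fun_pair.
pose X : set (measurableTypeR R * measurableTypeR R) :=
  (fun z : R * R => z.1 + c * z.2) @^-1` A.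
have mX : measurable X.
  have mlin : measurable_fun [set: measurableTypeR R * measurableTypeR R]
      (fun z : R * R => z.1 + c * z.2).
    by apply: measurable_funD => //; apply: measurable_funM.
  by rewrite -[X in measurable X]setTI; exact: mlin.
pose m' := measure_function_pushforward__canonical__measure_function_Measure
  (mrestr P mE) mUV.
pose m1 : {sigma_finite_measure set (measurableTypeR R) -> \bar R} :=
  mscale C (centered_normal R v).
have := @product_measure_unique _ _ _ _ _ m1
  (normal_prob 0 s : {sigma_finite_measure set (measurableTypeR R) -> \bar R})
  m' _ X mX.
rewrite {1}/m' /= /pushforward /mrestr /= => <-; last first.
  move=> B1 B2 mB1 mB2; rewrite /m' /= /pushforward /mrestr /m1 /= /mscale /=.
  by rewrite -HUV.
rewrite /product_measure1 /= /m1 ge0_integral_mscale //=.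
  rewrite -centered_normal_convolution //; congr (_ * _)%E.
  apply: eq_integral => x _; congr (normal_prob _ _ _).
  by apply/seteqP; split=> z /=; rewrite /xsection /= inE.
exact: measurable_fun_xsection.
Qed.

Section gaussian_combination.
Context {R : realType} {d} {Omega : measurableType d} {P : probability Omega R}.
Variables (n : nat) (Z : 'I_n -> {RV P >-> R}) (s : R) (c : 'I_n -> R).
Hypotheses (s0 : s != 0) (HZ : isotropic_gaussian Z s).

(* The later coordinates are carried along so that the independence of a
   partial sum from the next coordinate is part of the induction hypothesis. *)
Let partial_sum_law k : (k <= n)%N ->
  forall (A : set R) (B : 'I_n -> set R),
    measurable A -> (forall i, measurable (B i)) ->
    P ([set w | A (\sum_(i < n | (i < k)%N) c i * Z i w)] `&`
       [set w | forall i : 'I_n, (k <= i)%N -> B i (Z i w)]) =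
    (\prod_(i < n | (k <= i)%N) normal_prob 0 s (B i) *
     centered_normal R (\sum_(i < n | (i < k)%N) (c i * s) ^+ 2) A)%E.
Proof.
have [indep law] := HZ.
elim: k => [_ A B mA mB|k IH kn A B mA mB].
  rewrite (eq_bigl xpred0 (fun i => (c i * s) ^+ 2)) // big_pred0_eq.
  have -> : (\prod_(i < n | (0 <= i)%N) normal_prob 0 s (B i) =
             P [set w | forall i : 'I_n, (0 <= i)%N -> B i (Z i w)])%E.
    rewrite (_ : [set w | _] = [set w | forall i, i \in [set: 'I_n]%SET -> B i (Z i w)]).
      rewrite indep //; apply: eq_big => [i|i _]; first by rewrite inE.
      exact: esym (law i _ (mB i)).
    by apply/seteqP; split=> w /= H i _; apply: H; rewrite ?inE.
  (* The empty sum is the constant 0, whose law is the Dirac mass. *)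
  rewrite /centered_normal eqxx /= diracE.
  under [X in (X `&` _)%classic]eq_set => w do
    rewrite (eq_bigl xpred0 (fun i => c i * Z i w)) // big_pred0_eq.
  have [/set_mem A0|A0] := boolP (0 \in A).
    by rewrite mule1 (_ : [set _ | _] = setT) ?setTI //; apply/seteqP; split.
  rewrite mule0 (_ : [set _ | _] = set0) ?set0I ?measure0 //.
  by apply/seteqP; split=> // w /= /mem_set; rewrite (negPf A0).
pose k0 := Ordinal kn.
have ltE (i : 'I_n) : (i < k.+1)%N = (i == k0) || (i < k)%N.
  by rewrite ltnS leq_eqVlt.
have geE (i : 'I_n) : (k <= i)%N = (i == k0) || (k < i)%N.
  by rewrite leq_eqVlt eq_sym.
have sumE (F : 'I_n -> R) : \sum_(i < n | (i < k.+1)%N) F i =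
    \sum_(i < n | (i < k)%N) F i + F k0.
  rewrite (bigD1 k0) //=.
  rewrite addrC; congr (_ + _); apply: eq_bigl => i.
  by rewrite ltE; case: eqVneq => [->|]; rewrite ?ltnn ?andbF ?andbT.
have prodE (F : 'I_n -> \bar R) : (\prod_(i < n | (k <= i)%N) F i =
    F k0 * \prod_(i < n | (k.+1 <= i)%N) F i)%E.
  rewrite (bigD1 k0) //=.
  congr (_ * _)%E; apply: eq_bigl => i.
  by rewrite geE; case: eqVneq => [->|]; rewrite ?ltnn ?andbF ?andbT.
pose E := [set w | forall i : 'I_n, (k.+1 <= i)%N -> B i (Z i w)].
have mE : measurable E.
  rewrite (_ : E = \bigcap_(i in [set i : 'I_n | (k < i)%N]) Z i @^-1` B i) //.
  apply: fin_bigcap_measurable => // i _.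
  by rewrite -[X in measurable X]setTI; exact: measurable_funP.
(* The product must be a finite nonnegative real to serve as a scaling factor of a measure. *)
have [C CE] : exists C : {nonneg R},
    (C%:num%:E = \prod_(i < n | (k.+1 <= i)%N) normal_prob 0 s (B i))%E.
  apply: (big_ind (fun x => exists C : {nonneg R}, C%:num%:E = x)%E).
  - by exists 1%:nng.
  - by move=> _ _ [C1 <-] [C2 <-]; exists (C1%:num * C2%:num)%:nng.
  - move=> i _; exists (NngNum (fine_ge0 (measure_ge0 (normal_prob 0 s) (B i)))).
    by rewrite /= fineK ?fin_num_measure //; exact: mB.
rewrite -CE sumE.
under [X in (X `&` _)%classic]eq_set => w do rewrite sumE.
apply: (normal_combination_restr _ _ _ _
  (fun w => \sum_(i < n | (i < k)%N) c i * Z i w) (Z k0)) => //.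
- under eq_fun do rewrite big_mkcond.
  by apply: measurable_sum => i; case: (i < k)%N => //; exact: measurable_funM.
- by apply: sumr_ge0 => i _; rewrite sqr_ge0.
move=> A' B' mA' mB'.
(* Replacing the constraint on coordinate [k] by [B'] lets the induction hypothesis give the joint
   law of the partial sum and [Z k0] on [E]. *)
pose B2 i := if i == k0 then B' else B i.
have mB2 i : measurable (B2 i) by rewrite /B2; case: ifP.
have B2k0 : B2 k0 = B' by rewrite /B2 eqxx.
have := IH (ltnW kn) A' B2 mA' mB2; rewrite prodE B2k0.
rewrite (eq_bigr (fun i => normal_prob 0 s (B i))); last first.
  by move=> i ki; rewrite /B2; case: eqVneq ki => // ->; rewrite /= ltnn.
rewrite -CE => H; rewrite muleAC [(_ * normal_prob _ _ _)%E]muleC -H.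
rewrite -setIA; congr (P (_ `&` _)).
apply/seteqP; split=> w /=.
  move=> [Bw Ew] i; rewrite geE /B2; case: eqVneq => [-> _ //|_ /= ki].
  exact: Ew.
move=> H2; split; first by have := H2 k0; rewrite /B2 eqxx; apply.
move=> i ki; have := H2 i (ltnW ki); rewrite /B2; case: eqVneq => // ik.
by move: ki; rewrite ik /= ltnn.
Qed.

Lemma gaussian_combination_law (A : set R) : measurable A ->
  P [set w | A (\sum_(i < n) c i * Z i w)] =
  centered_normal R (\sum_(i < n) (c i * s) ^+ 2) A.
Proof.
move=> mA; have := partial_sum_law _ (leqnn n) _ (fun=> setT) mA (fun=> measurableT).
rewrite big_pred0 ?mul1e; last by move=> i; rewrite leqNgt ltn_ord.
rewrite (eq_bigl xpredT); last by move=> i; rewrite ltn_ord.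
move=> <-; congr (P _); apply/seteqP; split=> w /=.
  by move=> Aw; split=> //; rewrite (eq_bigl xpredT) // => i; rewrite ltn_ord.
by move=> [Aw _]; move: Aw; rewrite (eq_bigl xpredT) // => i; rewrite ltn_ord.
Qed.

End gaussian_combination.

(** * Uniform control of the noise over the columns *)

Lemma gaussian_correlation_bound d (Omega : measurableType d) (R : realType)
    (P : probability Omega R) (n p : nat) (X : 'M[R]_(n, p)) (sigma delta : R)
    (eps : 'I_n -> {RV P >-> R}) :
  (0 < n)%N -> (0 < p)%N -> (forall j, sqnorm2 (col j X) = n%:R) ->
  0 < sigma -> isotropic_gaussian eps sigma -> 0 < delta < 1 ->
  with_probability_at_least P (1 - delta)
    [set w | forall j, `|\sum_i X i j * eps i w| <=
       n%:R * (sigma * Num.sqrt (2 * ln (p%:R / delta) / n%:R))].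
Proof.
move=> n0 p0 Xcol sig0 Heps /andP[d0 d1].
have nR : 0 < n%:R :> R by rewrite ltr0n.
have pR : 0 < p%:R :> R by rewrite ltr0n.
set T := n%:R * _.
(* This makes the logarithm nonnegative, so that [Num.sqrt] does not fall back to its default 0. *)
have pd1 : 1 <= p%:R / delta.
  by rewrite ler_pdivlMr // mul1r (le_trans (ltW d1)) // ler1n.
have ln0 := ln_ge0 pd1.
have T0 : 0 <= T by rewrite !mulr_ge0 ?sqrtr_ge0 // ltW.
(* Each correlation has variance n sigma^2, so the tail exponent T^2/(2 n sigma^2) is exactly
   ln(p/delta) and each column costs delta/p. *)
have T2 : T ^+ 2 = 2 * n%:R * sigma ^+ 2 * ln (p%:R / delta).
  rewrite /T !exprMn sqr_sqrtr; first by field; rewrite lt0r_neq0.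
  by rewrite divr_ge0 ?mulr_ge0 // ltW.
pose bad j := [set w | T < `|\sum_i X i j * eps i w|].
have mT : measurable [set x : R | T < `|x|].
  have -> : [set x : R | T < `|x|] = ~` [set` `[- T, T]].
    by apply/seteqP; split=> x /=; rewrite in_itv /= -ler_norml; [rewrite ltNge => /negP|move=> /negP; rewrite -ltNge].
  by apply: measurableC; exact: measurable_itv.
have mbad j : measurable (bad j).
  have mS : measurable_fun [set: Omega] (fun w => \sum_i X i j * eps i w).
    by apply: measurable_sum => i; exact: measurable_funM.
  by have := mS measurableT _ mT; rewrite setTI.
have Pbad j : (P (bad j) <= (delta / p%:R)%:E)%E.
  have sn : sigma != 0 by rewrite lt0r_neq0.
  have := gaussian_combination_law n eps sigma (fun i => X i j) sn Heps _ mT.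
  have -> : \sum_i (X i j * sigma) ^+ 2 = n%:R * sigma ^+ 2.
    rewrite -(Xcol j) /sqnorm2 mulr_suml; apply: eq_bigr => i _.
    by rewrite exprMn !mxE.
  have v0 : 0 < n%:R * sigma ^+ 2 by rewrite mulr_gt0 // exprn_gt0.
  rewrite centered_normalE ?lt0r_neq0 // => ->.
  apply: le_trans (normal_prob_tail _ _ _ _ T0) _; first by rewrite sqrtr_eq0 -ltNge.
  rewrite lee_fin sqr_sqrtr ?(ltW v0) // T2.
  rewrite [X in expR X](_ : _ = - ln (p%:R / delta)); last first.
    by field; rewrite !lt0r_neq0.
  by rewrite expRN lnK ?posrE ?divr_gt0 // invf_div.
have [mU PU] : measurable (\big[setU/set0]_j bad j) /\
    (P (\big[setU/set0]_j bad j) <= \sum_(j < p) (delta / p%:R)%:E)%E.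
  apply: (big_ind2 (fun A x => measurable A /\ (P A <= x)%E)) => //.
  - by rewrite measure0.
  - move=> A x B y [mA Ax] [mB By]; split; first exact: measurableU.
    exact: le_trans (measureU2 _ mA mB) (leeD Ax By).
exists (~` \big[setU/set0]_j bad j); split; first exact: measurableC.
  move=> w /= Uw j; rewrite leNgt; apply/negP => bw; apply: Uw.
  by rewrite (bigD1 j) //=; left.
rewrite probability_setC // EFinB leeB //.
by apply: le_trans PU _; rewrite sumEFin lee_fin sumr_const card_ord -[X in X <= _]mulr_natr divfK // lt0r_neq0.
Qed.

(** * First-order optimality for penalized least squares *)

Section variational_inequality.
Context {R : realType}.

Lemma sqnorm2E m (v : 'cV[R]_m) : sqnorm2 v = dotv v v.
Proof. by apply: eq_bigr => i _; rewrite expr2. Qed.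

Lemma dotvC m (u v : 'cV[R]_m) : dotv u v = dotv v u.
Proof. by apply: eq_bigr => i _; rewrite mulrC. Qed.

Lemma dotvDr m (u v w : 'cV[R]_m) : dotv u (v + w) = dotv u v + dotv u w.
Proof. by rewrite -big_split; apply: eq_bigr => i _; rewrite mxE mulrDr. Qed.

Lemma dotvZr m (a : R) (u v : 'cV[R]_m) : dotv u (a *: v) = a * dotv u v.
Proof. by rewrite mulr_sumr; apply: eq_bigr => i _; rewrite mxE mulrCA. Qed.

Lemma dotvDl m (u v w : 'cV[R]_m) : dotv (u + v) w = dotv u w + dotv v w.
Proof. by rewrite dotvC dotvDr !(dotvC _ w). Qed.

Lemma dotvZl m (a : R) (u v : 'cV[R]_m) : dotv (a *: u) v = a * dotv u v.
Proof. by rewrite dotvC dotvZr dotvC. Qed.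

Lemma dotvBr m (u v w : 'cV[R]_m) : dotv u (v - w) = dotv u v - dotv u w.
Proof. by rewrite -scaleN1r dotvDr dotvZr mulN1r. Qed.

Lemma dotvBl m (u v w : 'cV[R]_m) : dotv (u - v) w = dotv u w - dotv v w.
Proof. by rewrite dotvC dotvBr !(dotvC _ w). Qed.

Lemma sqnorm2_subZ m (u v : 'cV[R]_m) (t : R) :
  sqnorm2 (u - t *: v) = sqnorm2 u - 2 * t * dotv u v + t ^+ 2 * sqnorm2 v.
Proof.
by rewrite !sqnorm2E dotvBl !dotvBr !dotvZl !dotvZr (dotvC _ v u); ring.
Qed.

Lemma dotv_trmx m q (X : 'M[R]_(m, q)) (u : 'cV[R]_m) (v : 'cV[R]_q) :
  dotv (X^T *m u) v = dotv u (X *m v).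
Proof.
have dE k (a b : 'cV[R]_k) : dotv a b = (a^T *m b) 0 0.
  by rewrite mxE; apply: eq_bigr => i _; rewrite mxE.
by rewrite !dE trmx_mul trmxK mulmxA.
Qed.

Definition segment_convex q (g : 'cV[R]_q -> R) :=
  forall b z t, 0 < t <= 1 -> g (b + t *: (z - b)) <= g b + t * (g z - g b).

Lemma segment_convex_l1norm q : segment_convex _ (@l1norm R q).
Proof.
move=> b z t /andP[t0 t1]; rewrite /l1norm -sumrB mulr_sumr -big_split /=.
apply: ler_sum => i _; rewrite !mxE.
have -> : b i 0 + t * (z i 0 - b i 0) = (1 - t) * b i 0 + t * z i 0 by ring.
apply: le_trans (ler_normD _ _) _; rewrite !normrM (gtr0_norm t0) ger0_norm ?subr_ge0 //.
by rewrite le_eqVlt; apply/orP; left; apply/eqP; ring.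
Qed.

(** Moving from [b] by a fraction [t] towards [z] gains at least [t] times the violation [u] and
    loses a term quadratic in [t], so a small explicit [t] contradicts minimality without any
    limit. *)
Lemma argmin_variational n q (X : 'M[R]_(n, q)) (y : 'cV[R]_n)
    (g : 'cV[R]_q -> R) (b : 'cV[R]_q) :
  segment_convex _ g -> is_argmin (fun b' => least_squares X y b' + g b') b ->
  forall z, n%:R^-1 * dotv (y - X *m b) (X *m (z - b)) <= g z - g b.
Proof.
move=> gconv bmin z; set h := X *m (z - b); set c := y - X *m b.
rewrite leNgt; apply/negP => lt.
set u := n%:R^-1 * dotv c h - (g z - g b).
have u0 : 0 < u by rewrite subr_gt0.
have quad t : 0 < t <= 1 -> u <= t * ((2 * n%:R)^-1 * sqnorm2 h).
  move=> t01; have := bmin (b + t *: (z - b)).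
  have /andP[t0 _] := t01.
  rewrite /least_squares mulmxDr -scalemxAr opprD addrA -/h -[y - _]/c.
  rewrite sqnorm2_subZ invfM.
  move=> bm; have := gconv b z t t01 => gt.
  rewrite -(ler_pM2l t0) /u; lra.
set B := (2 * n%:R)^-1 * sqnorm2 h in quad.
have B0 : 0 < B.
  by have := quad 1; rewrite ltr01 lexx mul1r => /(_ isT); exact: lt_le_trans.
have uB : u <= B by have := quad 1; rewrite ltr01 lexx mul1r; exact.
have B20 : 0 < 2 * B by rewrite mulr_gt0.
(* At [t = u / (2 * B)] the bound reads [u <= u / 2]; the case [t = 1] gave [u <= B], which keeps
   this [t] admissible. *)
have t01 : 0 < u / (2 * B) <= 1.
  by rewrite divr_gt0 //= ler_pdivrMr // mul1r; lra.
have := quad _ t01.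
have -> : u / (2 * B) * B = u / 2 by field; rewrite lt0r_neq0.
lra.
Qed.

End variational_inequality.

(** * Cone conditions and the deterministic oracle inequality *)

Section refitting_bound.
Context {R : realType} {n p : nat}.
Implicit Types (X : 'M[R]_(n, p)) (S : {set 'I_p}) (b z D : 'cV[R]_p).

Lemma l1norm_split S D : l1norm D = l1norm_on S D + l1norm_on (~: S) D.
Proof.
rewrite /l1norm (bigID (mem S)) /=; congr (_ + _).
by apply: eq_bigl => i; rewrite inE.
Qed.

Lemma l1norm_sub_le_support z b :
  l1norm z - l1norm b <=
  l1norm_on (vsupport z) (z - b) - l1norm_on (~: vsupport z) (z - b).
Proof.
rewrite (l1norm_split (vsupport z) z) (l1norm_split (vsupport z) b).
have le1 : l1norm_on (vsupport z) z - l1norm_on (vsupport z) b <=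
    l1norm_on (vsupport z) (z - b).
  rewrite -sumrB; apply: ler_sum => i _; rewrite !mxE.
  exact: le_trans (ler_norm _) (ler_dist_dist _ _).
have -> : l1norm_on (~: vsupport z) z = 0.
  by rewrite /l1norm_on big1 // => i; rewrite !inE negbK => /eqP ->; rewrite normr0.
have -> : l1norm_on (~: vsupport z) (z - b) = l1norm_on (~: vsupport z) b.
  apply: eq_bigr => i; rewrite !inE negbK !mxE => /eqP ->.
  by rewrite sub0r normrN.
lra.
Qed.

Lemma dotv_le_l1norm (q : nat) (u v : 'cV[R]_q) (M : R) :
  (forall i, `|u i 0| <= M) -> `|dotv u v| <= M * l1norm v.
Proof.
move=> uM; rewrite /l1norm mulr_sumr; apply: le_trans (ler_norm_sum _ _ _) _.
by apply: ler_sum => i _; rewrite normrM ler_wpM2r.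
Qed.

(** No cone hypothesis is needed: outside the cone the left side is nonpositive and the right side
    nonnegative. Inside it, AM-GM on [S] produces [sqnorm2_on S D], which the restricted eigenvalue
    absorbs into the prediction error. *)
Lemma restricted_eigenvalue_young X (c0 kappa mu : R) s S D :
  restricted_eigenvalue X c0 s kappa -> (#|S| <= s)%N -> (0 < n)%N -> 0 <= mu ->
  mu * (c0 * l1norm_on S D - l1norm_on (~: S) D) <=
  2^-1 * (n%:R^-1 * sqnorm2 (X *m D)) + 2^-1 * ((mu * c0) ^+ 2 * s%:R / kappa ^+ 2).
Proof.
move=> [c00 _ k0 RE] Ss n0 mu0.
have nR : 0 < n%:R :> R by rewrite ltr0n.
have k20 : 0 < kappa ^+ 2 by rewrite exprn_gt0.
have sq0 q (v : 'cV[R]_q) : 0 <= sqnorm2 v by apply: sumr_ge0 => i _; exact: sqr_ge0.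
have A0 : 0 <= n%:R^-1 * sqnorm2 (X *m D) by rewrite mulr_ge0 ?invr_ge0 // ltW.
have B0 : 0 <= (mu * c0) ^+ 2 * s%:R / kappa ^+ 2.
  by rewrite divr_ge0 ?mulr_ge0 ?sqr_ge0 // ltW.
have rhs0 : 0 <= 2^-1 * (n%:R^-1 * sqnorm2 (X *m D)) +
    2^-1 * ((mu * c0) ^+ 2 * s%:R / kappa ^+ 2) by lra.
have [cone|ncone] := leP (l1norm_on (~: S) D) (c0 * l1norm_on S D); last first.
  by apply: le_trans rhs0; rewrite mulr_ge0_le0 // subr_le0 ltW.
have Sc0 : 0 <= l1norm_on (~: S) D by apply: sumr_ge0.
(* The restricted eigenvalue speaks only of vectors nonzero on [S]; if [D] vanishes there, the left
   side is again nonpositive. *)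
have [ex|nex] := boolP [exists j in S, D j 0 != 0]; last first.
  have -> : l1norm_on S D = 0.
    rewrite /l1norm_on big1 // => j jS; move: nex; rewrite negb_exists => /forallP /(_ j).
    by rewrite jS /= negbK => /eqP ->; rewrite normr0.
  by apply: le_trans rhs0; rewrite mulr0 sub0r mulrN oppr_le0 mulr_ge0.
have q0 : 0 < sqnorm2_on S D.
  have /existsP[j /andP[jS Dj]] := ex.
  rewrite /sqnorm2_on (bigD1 j) //= ltr_pwDl ?exprn_even_gt0 //.
  by apply: sumr_ge0 => i _; exact: sqr_ge0.
have := RE S D Ss _ cone.
rewrite ler_pdivlMr ?mulr_gt0 // => H.
have {H}kq : kappa ^+ 2 * sqnorm2_on S D <= n%:R^-1 * sqnorm2 (X *m D).
  have ex2 : exists2 j, j \in S & D j 0 != 0.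
    by have /existsP[j /andP[jS Dj]] := ex; exists j.
  rewrite mulrC [leRHS]mulrC ler_pdivlMr //; apply: le_trans (H ex2).
  by rewrite le_eqVlt; apply/orP; left; apply/eqP; ring.
(* AM-GM in each coordinate of [S] *)
have young : 2 * (mu * c0 * l1norm_on S D) <=
    kappa ^+ 2 * sqnorm2_on S D + #|S|%:R * ((mu * c0) ^+ 2 / kappa ^+ 2).
  rewrite /l1norm_on /sqnorm2_on !mulr_sumr.
  have -> : #|S|%:R * ((mu * c0) ^+ 2 / kappa ^+ 2) =
      \sum_(i in S) (mu * c0) ^+ 2 / kappa ^+ 2 by rewrite sumr_const mulr_natl.
  rewrite -big_split /=; apply: ler_sum => i _.
  rewrite -subr_ge0 -[D i 0 ^+ 2]real_normK ?num_real //.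
  have -> : kappa ^+ 2 * `|D i 0| ^+ 2 + (mu * c0) ^+ 2 / kappa ^+ 2 -
      2 * (mu * c0 * `|D i 0|) = (kappa * `|D i 0| - mu * c0 / kappa) ^+ 2.
    by field; rewrite lt0r_neq0.
  exact: sqr_ge0.
have card : #|S|%:R * ((mu * c0) ^+ 2 / kappa ^+ 2) <=
    (mu * c0) ^+ 2 * s%:R / kappa ^+ 2.
  rewrite [leRHS]mulrAC [leRHS]mulrC ler_wpM2r ?ler_nat //.
  by rewrite divr_ge0 ?sqr_ge0.
have muSc : 0 <= mu * l1norm_on (~: S) D by rewrite mulr_ge0.
lra.
Qed.

Lemma refitting_oracle_inequality X (y eps : 'cV[R]_n)
    (betastar betahat betabar : 'cV[R]_p) s
    (kappa1 kappa3 lambda1 lambda2 r lambda0 : R) :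
  (0 < n)%N -> #|vsupport betastar| = s ->
  y = X *m betastar + eps ->
  restricted_eigenvalue X 3 s kappa3 -> restricted_eigenvalue X 1 s kappa1 ->
  0 < lambda1 -> 0 < lambda2 -> r = lambda2 / lambda1 ->
  lambda1 = (1 + 2 * r) / r * (2 * lambda0) ->
  (forall j, `|(X^T *m eps) j 0| <= n%:R * lambda0) ->
  lasso_solution X y lambda1 betahat ->
  bregman_lasso_refitting X y lambda1 lambda2 betahat betabar ->
  (r + 2) / r * (n%:R^-1 * sqnorm2 (X *m (betastar - betabar)))
    + n%:R^-1 * sqnorm2 (X *m (betastar - betahat))
  <= lambda1 ^+ 2 * s%:R / kappa1 ^+ 2
     + 9 * lambda1 ^+ 2 * s%:R / (4 * kappa3 ^+ 2).
Proof.
move=> n0 Ss yE RE3 RE1 l1 l2 rE l1E noise lasso refit.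
have nR : 0 < n%:R :> R by rewrite ltr0n.
have r0 : 0 < r by rewrite rE divr_gt0.
have l2E : lambda2 = r * lambda1 by rewrite rE divfK // lt0r_neq0.
set a := X *m (betastar - betabar); set b := X *m (betastar - betahat).
have resa : y - X *m betabar = a + eps by rewrite yE /a mulmxBr addrAC.
have resb : y - X *m betahat = b + eps by rewrite yE /b mulmxBr addrAC.
have hatV z : n%:R^-1 * dotv (b + eps) (X *m (z - betahat)) <=
    lambda1 * (l1norm z - l1norm betahat).
  rewrite -resb mulrBr.
  apply: (argmin_variational _ _ X y (fun b => lambda1 * l1norm b)) lasso z.
  move=> u v t t01; rewrite -mulrBr mulrCA -mulrDr ler_pM2l //.
  exact: segment_convex_l1norm.
have barV z : n%:R^-1 * dotv (a + eps) (X *m (z - betabar)) <=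
    r * (lambda1 * (l1norm z - l1norm betabar) -
         n%:R^-1 * dotv (b + eps) (X *m (z - betabar))).
  set rho := lasso_subgradient X y lambda1 betahat.
  have rhoE h : lambda2 * dotv rho h = r * (n%:R^-1 * dotv (b + eps) (X *m h)).
    rewrite /rho /lasso_subgradient dotvZl dotv_trmx resb l2E.
    by field; rewrite !lt0r_neq0.
  (* In its first argument the Bregman divergence is the l1-norm plus an affine function, so it
     inherits convexity. *)
  have gconv : segment_convex _ (fun b' => lambda2 * bregman_l1 rho b' betahat).
    move=> u v t t01; rewrite -mulrBr mulrCA -mulrDr ler_pM2l // /bregman_l1.
    rewrite !dotvBr dotvDr dotvZr dotvBr.
    have := segment_convex_l1norm _ u v t t01; lra.
  have := argmin_variational _ _ X y _ _ gconv refit z.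
  rewrite resa => /le_trans; apply.
  have := rhoE (z - betabar); rewrite l2E /bregman_l1 !(dotvBr _ rho); lra.
have hb : betabar - betahat = (betastar - betahat) - (betastar - betabar).
  by apply/matrixP => i j; rewrite !mxE; ring.
have bh : betahat - betabar = (betastar - betabar) - (betastar - betahat).
  by apply/matrixP => i j; rewrite !mxE; ring.
have I1 := barV betastar; have I2 := hatV betastar.
have I3 := hatV betabar; have I4 := barV betahat.
rewrite -/a in I1; rewrite -/b in I2.
rewrite hb mulmxBr -/a -/b in I3; rewrite bh mulmxBr -/a -/b in I4.
rewrite !dotvDl !dotvBr ?(dotvC _ b a) in I1 I2 I3 I4.
have noisea : `|dotv eps a| <= n%:R * lambda0 * l1norm (betastar - betabar).
  by rewrite /a -dotv_trmx; exact: dotv_le_l1norm.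
have muh : 0 <= lambda1 / 2 by rewrite divr_ge0 // ltW.
have Ssle : (#|vsupport betastar| <= s)%N by rewrite Ss.
(* With LS and LC the norms on and off the support, penalty and noise give lambda1 (LS - LC) +
   (lambda1/2)(LS + LC) = (lambda1/2)(3 LS - LC), hence the weight lambda1/2 and the constant 3. *)
have Ya := restricted_eigenvalue_young X 3 kappa3 _ s _ (betastar - betabar) RE3 Ssle n0 muh.
have Yb := restricted_eigenvalue_young X 1 kappa1 _ s _ (betastar - betahat) RE1 Ssle n0 (ltW l1).
rewrite -/a in Ya; rewrite -/b in Yb.
have La := l1norm_sub_le_support betastar betabar.
have Lb := l1norm_sub_le_support betastar betahat.
rewrite (l1norm_split (vsupport betastar)) in noisea.
rewrite !sqnorm2E in Ya Yb *.
set LS := l1norm_on (vsupport betastar) (betastar - betabar) in La noisea Ya.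
set LC := l1norm_on (~: _) (betastar - betabar) in La noisea Ya.
(* Adding [I4] to r times [I3] cancels all penalty and subgradient terms and leaves <a + eps, a - b>
   <= 0. *)
have {}I3 := ler_wpM2l (ltW r0) I3.
have {}La := ler_wpM2l (ltW l1) La.
have {}Lb := ler_wpM2l (ltW l1) Lb.
pose q := r^-1.
have q0 : 0 < q by rewrite invr_gt0.
have rq : r * q = 1 by rewrite divff // lt0r_neq0.
have {}I1 : q * (n%:R^-1 * (dotv a a + dotv eps a)) <=
    lambda1 * (l1norm betastar - l1norm betabar) -
    n%:R^-1 * (dotv a b + dotv eps a).
  by rewrite mulrC ler_pdivrMr // [leRHS]mulrC.
(* The calibration of [lambda1]: the noise term carries the weight 2 + 1/r, and this turns [lambda0]
   into half of [lambda1]. *)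
have q2l : (2 + q) * lambda0 = lambda1 / 2.
  by rewrite l1E /q; field; rewrite lt0r_neq0.
have {}noisea : - ((2 + q) * (n%:R^-1 * dotv eps a)) <= lambda1 / 2 * (LS + LC).
  rewrite -q2l -mulrA -mulrN ler_pM2l ?addr_gt0 //.
  rewrite -mulrN mulrC ler_pdivrMr // mulrC mulrA.
  by apply: le_trans (ler_norm _) _; rewrite normrN.
have -> : (r + 2) / r = 1 + 2 * q by rewrite /q; field; rewrite lt0r_neq0.
have K3 : 9 * lambda1 ^+ 2 * s%:R / (4 * kappa3 ^+ 2) =
    (lambda1 / 2 * 3) ^+ 2 * s%:R / kappa3 ^+ 2.
  by have [_ _ k0 _] := RE3; field; rewrite lt0r_neq0.
rewrite K3 -[X in X ^+ 2 * s%:R / kappa1 ^+ 2]mulr1.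
(* [Ya] and [Yb] absorb half of each prediction error, leaving the weights 1/2 + q and 1/2; doubling
   gives 1 + 2q and 1. *)
lra.
Qed.

End refitting_bound.

Theorem theorem5 (R : realType) (d : measure_display)
    (Omega : measurableType d) (P : probability Omega R)
    (n p s : nat) (X : 'M[R]_(n, p)) (betastar : 'cV[R]_p)
    (sigma : R) (eps : 'I_n -> {RV P >-> R}) (y : Omega -> 'cV[R]_n)
    (kappa1 kappa3 lambda1 lambda2 r delta : R)
    (betahat betabar : Omega -> 'cV[R]_p) :
  (0 < n)%N ->
  (forall j : 'I_p, sqnorm2 (col j X) = n%:R) ->
  #|vsupport betastar| = s ->
  0 < sigma ->
  isotropic_gaussian eps sigma ->
  (forall w, y w = X *m betastar + \col_i eps i w) ->
  restricted_eigenvalue X 3 s kappa3 ->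
  restricted_eigenvalue X 1 s kappa1 ->
  0 < lambda1 ->
  0 < lambda2 ->
  r = lambda2 / lambda1 ->
  0 < delta < 1 ->
  lambda1 = (1 + 2 * r) / r *
    (2 * sigma * Num.sqrt (2 * ln (p%:R / delta) / n%:R)) ->
  (forall w, lasso_solution X (y w) lambda1 (betahat w)) ->
  (forall w, bregman_lasso_refitting X (y w) lambda1 lambda2
               (betahat w) (betabar w)) ->
  with_probability_at_least P (1 - delta)
    [set w | (r + 2) / r * (n%:R^-1 * sqnorm2 (X *m (betastar - betabar w)))
             + n%:R^-1 * sqnorm2 (X *m (betastar - betahat w))
           <= lambda1 ^+ 2 * s%:R / kappa1 ^+ 2
              + 9 * lambda1 ^+ 2 * s%:R / (4 * kappa3 ^+ 2)].
Proof.
move=> n0 Xcol Ss sig0 Heps yE RE3 RE1 l1 l2 rE d01 l1E lasso refit.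
have [_ /andP[s0 sp] _ _] := RE3.
have [E [mE EA PE]] := gaussian_correlation_bound _ _ _ _ n p X sigma delta eps
  n0 (leq_trans s0 sp) Xcol sig0 Heps d01.
(* [E] depends on the noise alone, so the deterministic bound applies pointwise on it to whichever
   minimizers are chosen. *)
exists E; split=> // w /EA noise /=.
apply: (refitting_oracle_inequality X (y w) (\col_i eps i w) _ _ _ s _ _
  lambda1 lambda2 r (sigma * Num.sqrt (2 * ln (p%:R / delta) / n%:R))) => //.
  by rewrite [LHS]l1E -(mulrA 2).
move=> j; rewrite mxE; have := noise j.
by under [X in _ -> `|X| <= _]eq_bigr do rewrite !mxE.
Qed.
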